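(* Let $A$ be a commutative ring with $1$, and let $M$ be the additive subgroup of $A$ generated by the elements $x(a^2-1)$ and $3(b+1)(c+1)$ with $x\in A$ and $a,b,c\in A^\times$. Then there is an exact sequence $$\mathrm{K}_2(2,A)/\mathrm{C}(2,A)\longrightarrow A/M\longrightarrow \mathrm{E}_2(A)^{\mathrm{ab}}\longrightarrow 1 .$$ In particular, if $\mathrm{K}_2(2,A)$ is generated by Dennis-Stein symbols, then $\mathrm{E}_2(A)^{\mathrm{ab}}\simeq A/N$, where $N$ is the additive subgroup $$N:=M+\langle de(d+e-3) : d,e\in A \text{ such that } 1-de\in A^\times\rangle$$ of $A$, and $\langle\cdots\rangle$ denotes the additive subgroup generated by the listed elements.
   Context: $A^\times$ is the group of units of $A$, and $G^{\mathrm{ab}}=G/[G,G]$. $\mathrm{E}_2(A)$ is the subgroup of $\mathrm{GL}_2(A)$ generated by the elementary matrices $E_{12}(a)=\begin{pmatrix}1&a\\ 0&1\end{pmatrix}$ and $E_{21}(a)=\begin{pmatrix}1&0\\ a&1\end{pmatrix}$, $a\in A$. The Steinberg group $\mathrm{St}(2,A)$ is the group with generators $x_{12}(r),x_{21}(s)$, $r,s\in A$, subject to the following relations for $\{i,j\}=\{1,2\}$: $x_{ij}(r)x_{ij}(s)=x_{ij}(r+s)$ for $r,s\in A$, and $w_{ij}(u)x_{ji}(r)w_{ij}(u)^{-1}=x_{ij}(-uru)$ for $u\in A^\times$, $r\in A$, where $w_{ij}(u):=x_{ij}(u)x_{ji}(-u^{-1})x_{ij}(u)$. $\mathrm{K}_2(2,A)$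 is the kernel of the homomorphism $\mathrm{St}(2,A)\to\mathrm{E}_2(A)$, $x_{ij}(r)\mapsto E_{ij}(r)$. For $u\in A^\times$ put $h_{ij}(u):=w_{ij}(u)w_{ij}(-1)$. The Steinberg symbols are $\{u,v\}:=h_{12}(uv)h_{12}(u)^{-1}h_{12}(v)^{-1}$, $u,v\in A^\times$; they are central in $\mathrm{St}(2,A)$ and lie in $\mathrm{K}_2(2,A)$. $\mathrm{C}(2,A)$ is the subgroup of $\mathrm{K}_2(2,A)$ generated by the Steinberg symbols. For $a,b\in A$ with $1-ab\in A^\times$, the Dennis-Stein symbol is $$\langle a,b\rangle_{ij}:=x_{ji}\Big(\frac{-b}{1-ab}\Big)x_{ij}(-a)x_{ji}(b)x_{ij}\Big(\frac{a}{1-ab}\Big)h_{ij}(1-ab)^{-1}\in \mathrm{K}_2(2,A).$$ In the exact sequence, the first map is induced by the restriction to $\mathrm{K}_2(2,A)$ of the homomorphism $\mathrm{St}(2,A)\to A/M$, $x_{12}(r)\mapsto -r$, $x_{21}(r)\mapsto r$, and the second map is induced by $y\mapsto E_{12}(y)$. *)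

(* Defs.v *)
From HB Require Import structures.
From mathcomp Require Import all_boot all_algebra.
From mathcomp Require Import boolp classical_sets.
From mathcomp Require Import ring.

Set Implicit Arguments.
Unset Strict Implicit.
Unset Printing Implicit Defensive.

Import GRing.Theory.

Local Open Scope ring_scope.
Local Open Scope classical_set_scope.
Local Open Scope quotient_scope.

Notation to_multiplicative := Algebra.to_multiplicative.

Section GeneratedSubgroup.
Variables (G : groupType) (X : set G).

Inductive generated : set G :=
| generated_in x of X x : generated x
| generated1 : generated 1%g
| generatedM x y of generated x & generated y : generated (x * y)%g
| generatedV x of generated x : generated (x^-1)%g.

Definition gen : {pred G} := fun x => `[< generated x >].

Lemma genP x : reflect (generated x) (x \in gen).
Proof. exact: asboolP. Qed.

Fact gen_mulg_closed : mulg_closed gen.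
Proof. by move=> x y /genP xX /genP yX; apply/genP/generatedM. Qed.
Fact gen_mem1 : 1%g \in gen.
Proof. exact/genP/generated1. Qed.
Fact gen_invg_closed : invg_closed gen.
Proof. by move=> x /genP xX; apply/genP/generatedV. Qed.

HB.instance Definition _ := isMulClosed.Build G gen gen_mulg_closed.
HB.instance Definition _ := isMul1Closed.Build G gen gen_mem1.
HB.instance Definition _ := isInvClosed.Build G gen gen_invg_closed.

End GeneratedSubgroup.

Section GeneratedAdditiveSubgroup.
Variables (V : zmodType) (X : set V).

Inductive zgenerated : set V :=
| zgenerated_in x of X x : zgenerated x
| zgenerated0 : zgenerated 0
| zgeneratedD x y of zgenerated x & zgenerated y : zgenerated (x + y)
| zgeneratedN x of zgenerated x : zgenerated (- x).

Definition zgen : {pred V} := fun x => `[< zgenerated x >].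

Lemma zgenP x : reflect (zgenerated x) (x \in zgen).
Proof. exact: asboolP. Qed.

Fact zgen_zmod_closed : zmod_closed zgen.
Proof.
split=> [|x y /zgenP xX /zgenP yX]; first exact/zgenP/zgenerated0.
exact/zgenP/zgeneratedD/zgeneratedN.
Qed.
HB.instance Definition _ := GRing.isZmodClosed.Build V zgen zgen_zmod_closed.

End GeneratedAdditiveSubgroup.

Section SumAdditiveSubgroup.
Variables (V : zmodType) (S T : zmodClosed V).

Definition zsum : {pred V} :=
  fun x => `[< exists s t, [/\ s \in S, t \in T & x = s + t] >].

Lemma zsumP x :
  reflect (exists s t, [/\ s \in S, t \in T & x = s + t]) (x \in zsum).
Proof. exact: asboolP. Qed.

Fact zsum_zmod_closed : zmod_closed zsum.
Proof.
split=> [|_ _ /zsumP[s [t [sS tT ->]]] /zsumP[s' [t' [sS' tT' ->]]]].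
  by apply/zsumP; exists 0, 0; rewrite !rpred0 addr0.
by apply/zsumP; exists (s - s'), (t - t'); rewrite !rpredB // opprD addrACA.
Qed.
HB.instance Definition _ := GRing.isZmodClosed.Build V zsum zsum_zmod_closed.

End SumAdditiveSubgroup.

Section SubgroupType.
Variables (G : groupType) (S : groupClosed G).

Record subg := Subg { subg_val : G; subg_mem : subg_val \in S }.

HB.instance Definition _ := [isSub for subg_val].
HB.instance Definition _ := [Choice of subg by <:].

Fact subg_group_closed : group_closed (fun x => x \in S).
Proof. by split; [exact: gpred1 | exact: gpredF]. Qed.

HB.instance Definition _ :=
  SubChoice_isSubGroup.Build G _ subg subg_group_closed.

End SubgroupType.

HB.mixin Record isNormalClosed (G : groupType) (S : {pred G}) := {
  gpred_conj : forall x y : G, x \in S -> (x ^ y)%g \in S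
}.

#[short(type="normalClosed")]
HB.structure Definition NormalClosed (G : groupType) :=
  {S of GroupClosed G S & isNormalClosed G S}.

Section QuotientGroup.
Variables (G : groupType) (S : normalClosed G).

Definition quotg_equiv (x y : G) := (x^-1 * y)%g \in S.

Lemma quotg_equiv_is_equiv : equiv_class_of quotg_equiv.
Proof.
split=> [x|x y|y x z]; rewrite /quotg_equiv ?mulVg ?gpred1 //.
  by rewrite -(gpredV S) invgM invgK.
by move=> xy yz; rewrite -(mulgK y x^-1%g) -mulgA gpredM.
Qed.
Canonical quotg_equivRel := EquivRelPack quotg_equiv_is_equiv.
Canonical quotg_encModRel := defaultEncModRel quotg_equiv.

Definition quotg := {eq_quot quotg_equiv}.

HB.instance Definition _ : EqQuotient G quotg_equiv quotg := EqQuotient.on quotg.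
HB.instance Definition _ := Choice.on quotg.

Definition quotg1 : quotg := \pi_quotg 1%g.
Definition quotgM (x y : quotg) : quotg := \pi_quotg (repr x * repr y)%g.
Definition quotgV (x : quotg) : quotg := \pi_quotg (repr x)^-1%g.

Lemma quotgP x y : x = y %[mod quotg] <-> (x^-1 * y)%g \in S.
Proof. by split=> [/eqP | xyS]; [|apply/eqP]; rewrite eqquotE. Qed.

Lemma pi_quotgM x y : \pi_quotg (x * y)%g = quotgM (\pi x) (\pi y).
Proof.
rewrite /quotgM; case: piP => x' /quotgP xx'; case: piP => y' /quotgP yy'; apply/quotgP.
rewrite invgM -mulgA [(x^-1 * _)%g]mulgA.
have -> : (y^-1 * (x^-1 * x' * y') = (x^-1 * x') ^ y * (y^-1 * y'))%g.
  by rewrite conjgE -!mulgA mulVKg.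
by rewrite gpredM ?gpred_conj.
Qed.

Lemma pi_quotgV x : \pi_quotg x^-1%g = quotgV (\pi x).
Proof.
rewrite /quotgV; case: piP => x' /quotgP xx'; apply/quotgP; rewrite invgK.
have -> : (x * x'^-1 = ((x^-1 * x')^-1) ^ (x^-1))%g.
  by rewrite conjgE invgM !invgK -!mulgA mulgV mulg1.
by rewrite gpred_conj ?gpredV.
Qed.

Lemma quotgMA : associative quotgM.
Proof.
move=> x y z; elim/quotW: x => x; elim/quotW: y => y; elim/quotW: z => z.
by rewrite -(pi_quotgM y z) -pi_quotgM -(pi_quotgM x y) -pi_quotgM mulgA.
Qed.
Lemma quotg1M : left_id quotg1 quotgM.
Proof. by move=> x; elim/quotW: x => x; rewrite -pi_quotgM mul1g. Qed.
Lemma quotgM1 : right_id quotg1 quotgM.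
Proof. by move=> x; elim/quotW: x => x; rewrite -pi_quotgM mulg1. Qed.
Lemma quotgVM : left_inverse quotg1 quotgV quotgM.
Proof. by move=> x; elim/quotW: x => x; rewrite -pi_quotgV -pi_quotgM mulVg. Qed.
Lemma quotgMV : right_inverse quotg1 quotgV quotgM.
Proof. by move=> x; elim/quotW: x => x; rewrite -pi_quotgV -pi_quotgM mulgV. Qed.

HB.instance Definition _ := isGroup.Build quotg quotgMA quotg1M quotgM1 quotgVM quotgMV.

Fact pi_quotg_is_morphism : monoid.monoid_morphism \pi_quotg.
Proof. by split=> [|x y] //; rewrite pi_quotgM. Qed.
HB.instance Definition _ :=
  isUMagmaMorphism.Build G quotg \pi_quotg pi_quotg_is_morphism.

End QuotientGroup.
Section Abelianization.
Variable G : groupType.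

Definition derived : {pred G} := gen [set [~ x, y]%g | x in setT & y in setT].
HB.instance Definition _ := GroupClosed.on derived.

Fact derived_conj (x y : G) : x \in derived -> (x ^ y)%g \in derived.
Proof.
move/genP; elim=> [_ [a _ [b _ <-]]||a b _ IHa _ IHb|a _ IHa].
- rewrite conjRg; apply/genP/generated_in.
  by exists (a ^ y)%g => //; exists (b ^ y)%g.
- by rewrite conj1g gpred1.
- by rewrite conjMg gpredM.
- by rewrite conjVg gpredV.
Qed.
HB.instance Definition _ := isNormalClosed.Build G derived derived_conj.

Definition ab := quotg derived.
HB.instance Definition _ := monoid.Group.on ab.

End Abelianization.

Arguments derived G : clear implicits.

(* The unit group of an arbitrary ring, possibly zero: a unit is packaged     *)
(* with its (unique) two-sided inverse. [GRing.unit] is only available over   *)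
(* nontrivial rings with decidable invertibility.                             *)
Section Units.
Variable R : pzRingType.

Record units := Units {
  upair : R * R;
  _ : (upair.1 * upair.2 == 1) && (upair.2 * upair.1 == 1)
}.

HB.instance Definition _ := [isSub for upair].
HB.instance Definition _ := [Choice of units by <:].

Definition uval (u : units) : R := (upair u).1.
Definition uinv (u : units) : R := (upair u).2.

Lemma uvalK (u : units) : uval u * uinv u = 1.
Proof. by rewrite /uval /uinv; case: u => p /= /andP[/eqP]. Qed.
Lemma uinvK (u : units) : uinv u * uval u = 1.
Proof. by rewrite /uval /uinv; case: u => p /= /andP[_ /eqP]. Qed.

Lemma uval_inj : injective uval.
Proof.
move=> u v eq_uv; apply/val_inj/injective_projections => //=.
rewrite -/(uinv u) -/(uinv v).
by rewrite -[uinv u]mulr1 -(uvalK v) mulrA -eq_uv uinvK mul1r.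
Qed.

Definition mku x y (xy : x * y = 1) (yx : y * x = 1) : units :=
  @Units (x, y) (introT andP (conj (introT eqP xy) (introT eqP yx))).

Definition unit1 : units := mku (mulr1 1) (mulr1 1).

Fact unitM_subproof (u v : units) :
  uval u * uval v * (uinv v * uinv u) = 1.
Proof. by rewrite mulrA -(mulrA (uval u)) uvalK mulr1 uvalK. Qed.
Fact unitM_subproof' (u v : units) :
  uinv v * uinv u * (uval u * uval v) = 1.
Proof. by rewrite mulrA -(mulrA (uinv v)) uinvK mulr1 uinvK. Qed.
Definition unitM u v := mku (unitM_subproof u v) (unitM_subproof' u v).

Definition unitV (u : units) := mku (uinvK u) (uvalK u).

Fact unitMA : associative unitM.
Proof. by move=> u v w; apply/uval_inj/mulrA. Qed.
Fact unit1M : left_id unit1 unitM.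
Proof. by move=> u; apply/uval_inj/mul1r. Qed.
Fact unitM1 : right_id unit1 unitM.
Proof. by move=> u; apply/uval_inj/mulr1. Qed.
Fact unitVM : left_inverse unit1 unitV unitM.
Proof. by move=> u; apply/uval_inj/uinvK. Qed.
Fact unitMV : right_inverse unit1 unitV unitM.
Proof. by move=> u; apply/uval_inj/uvalK. Qed.
HB.instance Definition _ :=
  isGroup.Build units unitMA unit1M unitM1 unitVM unitMV.

Fact unitN1_subproof : -1 * -1 = 1 :> R.
Proof. by rewrite mulrNN mulr1. Qed.
Definition unitN1 : units := mku unitN1_subproof unitN1_subproof.

End Units.

Bind Scope group_scope with units.
Arguments uval {R} u%_group_scope.
Arguments uinv {R} u%_group_scope.

Section Presentation.
Variable X : Type.

Inductive word :=
| word_gen of X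
| word1
| wordM of word & word
| wordV of word.

HB.instance Definition _ := hasMul.Build word wordM.
HB.instance Definition _ := hasOne.Build word word1.
HB.instance Definition _ := hasInv.Build word wordV.
HB.instance Definition _ := gen_eqMixin word.
HB.instance Definition _ := gen_choiceMixin word.

Variable R : word -> word -> Prop.

Inductive word_equiv : word -> word -> Prop :=
| word_rel a b of R a b : word_equiv a b
| word_refl a : word_equiv a a
| word_sym a b of word_equiv a b : word_equiv b a
| word_trans a b c of word_equiv a b & word_equiv b c : word_equiv a c
| word_equivM a a' b b' of word_equiv a a' & word_equiv b b' :
    word_equiv (a * b)%g (a' * b')%g
| word_equivV a a' of word_equiv a a' : word_equiv (a^-1)%g (a'^-1)%g
| word_mulA a b c : word_equiv (a * (b * c))%g (a * b * c)%g
| word_mul1 a : word_equiv (1 * a)%g a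
| word_mulr1 a : word_equiv (a * 1)%g a
| word_mulV a : word_equiv (a^-1 * a)%g 1%g
| word_mulrV a : word_equiv (a * a^-1)%g 1%g.

Definition word_eqb : rel word := fun a b => `[< word_equiv a b >].

Lemma word_eqP a b : reflect (word_equiv a b) (word_eqb a b).
Proof. exact: asboolP. Qed.

Fact word_eqb_equiv : equiv_class_of word_eqb.
Proof.
split=> [a|a b|b a c]; first exact/word_eqP/word_refl.
  by apply/word_eqP/word_eqP; apply: word_sym.
by move=> /word_eqP ab /word_eqP bc; apply/word_eqP/(word_trans ab bc).
Qed.
Canonical word_equivRel := EquivRelPack word_eqb_equiv.
Canonical word_encModRel := defaultEncModRel word_eqb.

Definition presented := {eq_quot word_eqb}.
HB.instance Definition _ : EqQuotient word word_eqb presented :=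
  EqQuotient.on presented.
HB.instance Definition _ := Choice.on presented.

Definition pgen (x : X) : presented := \pi_presented (word_gen x).

Definition presM (p q : presented) : presented :=
  \pi_presented (repr p * repr q)%g.
Definition presV (p : presented) : presented := \pi_presented (repr p)^-1%g.
Definition pres1 : presented := \pi_presented 1%g.

Lemma pres_eqP a b : a = b %[mod presented] <-> word_equiv a b.
Proof.
by split=> [/eqP | /word_eqP ab]; [|apply/eqP]; rewrite eqquotE // => /word_eqP.
Qed.

Lemma pi_presM a b : \pi_presented (a * b)%g = presM (\pi a) (\pi b).
Proof.
rewrite /presM; case: piP => a' /pres_eqP aa'; case: piP => b' /pres_eqP bb'.
exact/pres_eqP/word_equivM.
Qed.

Lemma pi_presV a : \pi_presented (a^-1)%g = presV (\pi a).
Proof.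
by rewrite /presV; case: piP => a' /pres_eqP aa'; apply/pres_eqP/word_equivV.
Qed.

Lemma presMA : associative presM.
Proof.
move=> x y z; elim/quotW: x => x; elim/quotW: y => y; elim/quotW: z => z.
rewrite -(pi_presM y z) -pi_presM -(pi_presM x y) -pi_presM.
exact/pres_eqP/word_mulA.
Qed.
Lemma pres1M : left_id pres1 presM.
Proof.
by move=> x; elim/quotW: x => x; rewrite -pi_presM; apply/pres_eqP/word_mul1.
Qed.
Lemma presM1 : right_id pres1 presM.
Proof.
by move=> x; elim/quotW: x => x; rewrite -pi_presM; apply/pres_eqP/word_mulr1.
Qed.
Lemma presVM : left_inverse pres1 presV presM.
Proof.
move=> x; elim/quotW: x => x; rewrite -pi_presV -pi_presM.
exact/pres_eqP/word_mulV.
Qed.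
Lemma presMV : right_inverse pres1 presV presM.
Proof.
move=> x; elim/quotW: x => x; rewrite -pi_presV -pi_presM.
exact/pres_eqP/word_mulrV.
Qed.

HB.instance Definition _ :=
  isGroup.Build presented presMA pres1M presM1 presVM presMV.

Section Lift.
Variables (G : groupType) (f : X -> G).

Fixpoint word_eval (a : word) : G :=
  match a with
  | word_gen x => f x
  | word1 => 1%g
  | wordM a b => (word_eval a * word_eval b)%g
  | wordV a => (word_eval a)^-1%g
  end.

Hypothesis fR : forall a b, R a b -> word_eval a = word_eval b.

Lemma word_eval_equiv a b : word_equiv a b -> word_eval a = word_eval b.
Proof.
elim=> {a b} [a b /fR // | // | a b _ -> // | a b c _ -> _ -> // | | | | | | |].
- by move=> a a' b b' _ /= -> _ ->.
- by move=> a a' _ /= ->.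
- by move=> a b c /=; rewrite mulgA.
- by move=> a /=; rewrite mul1g.
- by move=> a /=; rewrite mulg1.
- by move=> a /=; rewrite mulVg.
- by move=> a /=; rewrite mulgV.
Qed.

Definition pres_lift (p : presented) : G := word_eval (repr p).

Lemma pres_lift_pi a : pres_lift (\pi a) = word_eval a.
Proof.
by rewrite /pres_lift; case: piP => b /pres_eqP ab; rewrite (word_eval_equiv ab).
Qed.

Lemma pres_lift_gen x : pres_lift (pgen x) = f x.
Proof. exact: pres_lift_pi. Qed.

Fact pres_lift_is_morphism : monoid.monoid_morphism pres_lift.
Proof.
split=> [|p q]; first exact: (pres_lift_pi word1).
elim/quotW: p => a; elim/quotW: q => b.
by rewrite -[(_ * _)%g]pi_presM !pres_lift_pi.
Qed.

End Lift.
End Presentation.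

Lemma uvalM (R : pzRingType) (u v : units R) :
  uval (u * v)%g = uval u * uval v.
Proof. by []. Qed.

(* The pairs (i, j) with {i, j} = {1, 2} are encoded by booleans: [false]      *)
(* stands for 12 and [true] for 21, so that ji is the negation of ij.         *)

Section ElementaryGroup.
Variable A : comPzRingType.

Definition mx2 (a b c d : A) : 'M[A]_2 :=
  \matrix_(i, j) if i == 0 then (if j == 0 then a else b)
                 else (if j == 0 then c else d).

Lemma mx2M a b c d a' b' c' d' :
  mx2 a b c d * mx2 a' b' c' d' =
  mx2 (a * a' + b * c') (a * b' + b * d') (c * a' + d * c') (c * b' + d * d').
Proof.
apply/matrixP=> i j; rewrite !mxE 2!big_ord_recl big_ord0 !mxE /= addr0.
by case: (i == 0); case: (j == 0).
Qed.

Lemma mx2_1 : mx2 1 0 0 1 = 1.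
Proof.
by apply/matrixP=> -[[|[|i]] //= Hi] [[|[|j]] //= Hj]; rewrite !mxE.
Qed.

Definition elem_mx (ij : bool) (r : A) : 'M[A]_2 :=
  if ij then mx2 1 0 r 1 else mx2 1 r 0 1.

Fact elem_mxD ij r s : elem_mx ij r * elem_mx ij s = elem_mx ij (r + s).
Proof. by case: ij; rewrite mx2M; congr mx2; ring. Qed.

Fact elem_mxN ij r : elem_mx ij r * elem_mx ij (- r) = 1.
Proof. by rewrite elem_mxD subrr -mx2_1; case: ij. Qed.

Fact elem_mxN' ij r : elem_mx ij (- r) * elem_mx ij r = 1.
Proof. by rewrite elem_mxD addNr -mx2_1; case: ij. Qed.

Definition GL2 := units 'M[A]_2.
HB.instance Definition _ := monoid.Group.on GL2.

Definition elem_GL2 ij r : GL2 := mku (elem_mxN ij r) (elem_mxN' ij r).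

Definition E2 : {pred GL2} := gen [set elem_GL2 ij r | ij in setT & r in setT].
HB.instance Definition _ := GroupClosed.on E2.

Fact elem_E2_subproof ij r : elem_GL2 ij r \in E2.
Proof. by apply/genP/generated_in; exists ij => //; exists r. Qed.
Definition elem_E2 ij r : subg E2 := Subg (elem_E2_subproof ij r).

End ElementaryGroup.

Arguments E2 A : clear implicits.

Section SteinbergElements.
Variables (A : comPzRingType) (G : baseGroupType) (x : bool -> A -> G).

Definition stein_w (ij : bool) (u : units A) : G :=
  (x ij (uval u) * x (~~ ij) (- uval u^-1) * x ij (uval u))%g.

Definition stein_h (ij : bool) (u : units A) : G :=
  (stein_w ij u * stein_w ij (unitN1 A))%g.

Definition stein_symbol (u v : units A) : G :=
  (stein_h false (u * v) * (stein_h false u)^-1 * (stein_h false v)^-1)%g.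

(* The Dennis-Stein symbol <a,b>_ij, for a unit t equal to 1 - ab.            *)
Definition dennis_stein (ij : bool) (a b : A) (t : units A) : G :=
  (x (~~ ij) (- b * uval t^-1) * x ij (- a) * x (~~ ij) b
   * x ij (a * uval t^-1) * (stein_h ij t)^-1)%g.

End SteinbergElements.

Section SteinbergGroup.
Variable A : comPzRingType.

Definition St_word (ij : bool) (r : A) := word_gen (ij, r).

Local Notation X := St_word.
Inductive St_rel : word (bool * A) -> word (bool * A) -> Prop :=
| St_relD ij r s : St_rel (X ij r * X ij s)%g (X ij (r + s))
| St_relw ij u r :
    St_rel (stein_w X ij u * X (~~ ij) r * (stein_w X ij u)^-1)%g
           (X ij (- (uval u * r * uval u))).

Definition St := presented St_rel.
HB.instance Definition _ := monoid.Group.on St.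

Definition x_ (ij : bool) (r : A) : St := pgen St_rel (ij, r).

Lemma x_D ij r s : (x_ ij r * x_ ij s)%g = x_ ij (r + s).
Proof. by rewrite -[LHS]pi_presM; apply/pres_eqP/word_rel/St_relD. Qed.

Local Notation w := (stein_w x_).
Local Notation h := (stein_h x_).

Let piM a b : \pi_St (a * b)%g = (\pi_St a * \pi_St b)%g.
Proof. exact: pi_presM. Qed.
Let piV a : \pi_St (a^-1)%g = (\pi_St a)^-1%g.
Proof. exact: pi_presV. Qed.

Lemma x_w ij u r :
  (w ij u * x_ (~~ ij) r * (w ij u)^-1)%g = x_ ij (- (uval u * r * uval u)).
Proof.
have -> : x_ ij (- (uval u * r * uval u)) =
    \pi_St (stein_w X ij u * X (~~ ij) r * (stein_w X ij u)^-1)%g.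
  exact/pres_eqP/word_sym/word_rel/St_relw.
by rewrite /stein_w !(piM, piV).
Qed.

Lemma St_ind (P : St -> Prop) :
    (forall ij r, P (x_ ij r)) -> P 1%g ->
    (forall p q, P p -> P q -> P (p * q)%g) ->
    (forall p, P p -> P (p^-1)%g) ->
  forall p, P p.
Proof.
move=> Px P1 PM PV p; elim/quotW: p => a.
elim: a => [[ij r]||a IHa b IHb|a IHa]; first exact: Px.
- exact: P1.
- by rewrite [\pi _]piM; apply: PM.
- by rewrite [\pi _]piV; apply: PV.
Qed.

Lemma x_0 ij : x_ ij 0 = 1%g.
Proof. by apply: (mulgI (x_ ij 0)); rewrite x_D addr0 mulg1. Qed.

Lemma x_N ij r : x_ ij (- r) = (x_ ij r)^-1%g.
Proof. by apply: (mulgI (x_ ij r)); rewrite x_D subrr x_0 mulgV. Qed.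

Lemma w_V ij u : (w ij u)^-1%g = w ij (unitN1 A * u)%g.
Proof.
rewrite /stein_w !invgM -!x_N opprK mulgA !uvalM.
by rewrite [uval (unitN1 A)^-1%g]/uval /= mulrN1 mulN1r opprK.
Qed.

Let uvalKV (u : units A) : uval u * uval u^-1%g = 1.
Proof. exact: uvalK. Qed.

Lemma x_w' ij u r :
  (w ij u * x_ ij r * (w ij u)^-1)%g
  = x_ (~~ ij) (- (uval u^-1 * r * uval u^-1)).
Proof.
set s := - _; have := x_w ij (unitN1 A * u)%g s.
have -> : - (uval (unitN1 A * u) * s * uval (unitN1 A * u)) = r.
  rewrite /s uvalM /= mulN1r.
  by ring: (uvalKV u).
rewrite -w_V invgK => <-; move: (w ij u) => W.
by rewrite !mulgA mulgV mul1g mulgK.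
Qed.

Let act (u : units A) (ij : bool) r :=
  if ij then uval u^-1 * r * uval u^-1 else uval u * r * uval u.

Let hJ u ij r :
  (h false u * x_ ij r * (h false u)^-1)%g = x_ ij (act u ij r).
Proof.
have hE p : (h false u * p * (h false u)^-1 =
    w false u * (w false (unitN1 A) * p * (w false (unitN1 A))^-1)
    * (w false u)^-1)%g.
  rewrite /stein_h; move: (w false u) (w false _) => W W1.
  by rewrite invgM !mulgA.
have uN1V : uval (unitN1 A)^-1 = -1 by [].
rewrite hE; case: ij => /=.
  by rewrite x_w x_w' /act; congr x_; rewrite /= /uval /=; ring.
by rewrite x_w' uN1V (x_w false) /act; congr x_; ring.
Qed.

Let hVJ u ij r :
  ((h false u)^-1 * x_ ij r * h false u)%g = x_ ij (act u^-1 ij r).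
Proof.
have -> : x_ ij r = (h false u * x_ ij (act u^-1 ij r) * (h false u)^-1)%g.
  rewrite hJ /act invgK; congr x_.
  by case: ij; ring: (uvalKV u).
move: (h false u) => H; by rewrite !mulgA mulVg mul1g mulgVK.
Qed.

Lemma stein_symbol_central u v p :
  commute (stein_symbol x_ u v) p.
Proof.
elim/St_ind: p => [ij r||p q cp cq|p cp].
- have hC a q : (h false a * x_ ij q)%g = (x_ ij (act a ij q) * h false a)%g.
    by rewrite -hJ mulgVK.
  have hVC a q : ((h false a)^-1 * x_ ij q)%g
               = (x_ ij (act a^-1 ij q) * (h false a)^-1)%g.
    by rewrite -hVJ mulgK.
  have actK : act (u * v) ij (act u^-1 ij (act v^-1 ij r)) = r.
    rewrite /act invgM !invgK !uvalM.
    by case: ij {hC hVC}; ring: (uvalKV u) (uvalKV v).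
  rewrite /commute /stein_symbol -[in LHS]mulgA hVC mulgA.
  by rewrite -[(_ / _ * x_ _ _)%g]mulgA hVC mulgA hC actK -!mulgA.
- exact: commute1.
- exact: commuteM.
- exact: commuteV.
Qed.

Let e : bool -> A -> subg (E2 A) := @elem_E2 A.

Let mxE (g : subg (E2 A)) : 'M[A]_2 := uval (val g).
Let mxE_inj : injective mxE.
Proof. by move=> g g' /uval_inj/val_inj. Qed.
Let mxEM g g' : mxE (g * g')%g = mxE g * mxE g'.
Proof. by []. Qed.
Let mxEe ij r : mxE (e ij r) = elem_mx ij r.
Proof. by []. Qed.

Let mxEw ij u : mxE (stein_w e ij u) =
  if ij then mx2 0 (- uval u^-1) (uval u) 0
  else mx2 0 (uval u) (- uval u^-1) 0.
Proof.
rewrite /stein_w !mxEM !mxEe /elem_mx.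
by case: ij; rewrite /= !mx2M; congr mx2; ring: (uvalKV u).
Qed.

Let mxEh ij u : mxE (stein_h e ij u) =
  if ij then mx2 (uval u^-1) 0 0 (uval u)
  else mx2 (uval u) 0 0 (uval u^-1).
Proof.
have uN1E : (uval (unitN1 A) = -1) * (uval (unitN1 A)^-1 = -1) by [].
rewrite /stein_h mxEM !mxEw !uN1E.
by case: ij; rewrite /= !mx2M; congr mx2; ring.
Qed.

Definition St_E2_gen (X : bool * A) : subg (E2 A) := elem_E2 X.1 X.2.

Fact St_E2_subproof a b :
  St_rel a b -> word_eval St_E2_gen a = word_eval St_E2_gen b.
Proof.
case=> [ij r s|ij u r]; apply: mxE_inj; first exact: elem_mxD.
rewrite -[LHS]/(mxE (stein_w e ij u * e (~~ ij) r * (stein_w e ij u)^-1)%g).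
rewrite -[RHS]/(mxE (e ij (- (uval u * r * uval u)))).
congr mxE; apply: (mulIg (stein_w e ij u)); rewrite mulgVK; apply: mxE_inj.
rewrite (mxEM (stein_w _ _ _)) (mxEM (e _ _)) !mxEe mxEw /elem_mx.
by case: ij; rewrite /= !mx2M; congr mx2; ring: (uvalKV u).
Qed.

Definition St_E2 : St -> subg (E2 A) := @pres_lift _ St_rel _ St_E2_gen.

HB.instance Definition _ := isUMagmaMorphism.Build St (subg (E2 A)) St_E2
  (pres_lift_is_morphism St_E2_subproof).

Lemma St_E2_x ij r : St_E2 (x_ ij r) = elem_E2 ij r.
Proof. exact: (pres_lift_gen St_E2_subproof). Qed.

Lemma St_E2M : {morph St_E2 : p q / (p * q)%g}.
Proof. exact: gmulfM. Qed.
Lemma St_E2V : {morph St_E2 : p / (p^-1)%g}.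
Proof. exact: gmulfV. Qed.

Definition K2 : {pred St} := fun p => St_E2 p == 1%g.

Fact K2_mulg_closed : mulg_closed K2.
Proof.
by move=> p q /eqP p1 /eqP q1; apply/eqP; rewrite St_E2M p1 q1 mulg1.
Qed.
Fact K2_mem1 : 1%g \in K2.
Proof. by apply/eqP; rewrite gmulf1. Qed.
Fact K2_invg_closed : invg_closed K2.
Proof. by move=> p /eqP p1; apply/eqP; rewrite St_E2V p1 invg1. Qed.
HB.instance Definition _ := isMulClosed.Build St K2 K2_mulg_closed.
HB.instance Definition _ := isMul1Closed.Build St K2 K2_mem1.
HB.instance Definition _ := isInvClosed.Build St K2 K2_invg_closed.

Let St_E2_h ij u : St_E2 (h ij u) = stein_h e ij u.
Proof. by rewrite /stein_h /stein_w !St_E2M !St_E2_x. Qed.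

Fact stein_symbol_K2 u v : stein_symbol x_ u v \in K2.
Proof.
have hM : stein_h e false (u * v) =
          (stein_h e false v * stein_h e false u)%g.
  apply: mxE_inj; apply: (etrans (mxEh false (u * v)%g)); apply/esym.
  apply: (etrans (mxEM (stein_h e false v) (stein_h e false u))).
  apply: (etrans (congr2 *%R (mxEh false v) (mxEh false u))).
  by rewrite mx2M invgM !uvalM; congr mx2; ring.
apply/eqP; apply: (etrans (St_E2M _ _)).
rewrite St_E2M !St_E2V !St_E2_h hM; move: (stein_h e _ _) (stein_h e _ _).
by move=> a b; rewrite mulgK mulgV.
Qed.

Fact dennis_stein_K2 ij a b t :
  uval t = 1 - a * b -> dennis_stein x_ ij a b t \in K2.
Proof.
move=> tE; apply/eqP; rewrite /dennis_stein.
apply: (etrans (St_E2M _ _)); rewrite St_E2V St_E2_h 3!St_E2M !St_E2_x.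
apply: (mulIg (stein_h e ij t)); rewrite mulgVK mul1g; apply: mxE_inj.
rewrite mxEh -[LHS]/(elem_mx _ _ * elem_mx _ _ * elem_mx _ _ * elem_mx _ _).
have abt : a * b * uval t^-1 = uval t^-1 - 1.
  by rewrite -(uvalKV t) tE; ring.
by rewrite /elem_mx tE; case: ij; rewrite /= !mx2M; congr mx2; ring: abt.
Qed.

Definition K2_symbol u v : subg K2 := Subg (stein_symbol_K2 u v).

Definition C2 : {pred subg K2} :=
  gen [set K2_symbol u v | u in setT & v in setT].
HB.instance Definition _ := GroupClosed.on C2.

Fact C2_conj (x y : subg K2) : x \in C2 -> (x ^ y)%g \in C2.
Proof.
suff cC z : z \in C2 -> commute z y.
  by move=> xC; rewrite conjgE (cC x) // mulKg.
move/genP; elim=> {z} [_ [u _ [v _ <-]]||a b _ ca _ cb|a _ ca].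
- by apply: val_inj; apply: (stein_symbol_central u v).
- exact/commute_sym/commute1.
- by apply/commute_sym/commuteM; apply/commute_sym.
- by apply/commute_sym/commuteV/commute_sym.
Qed.
HB.instance Definition _ := isNormalClosed.Build (subg K2) C2 C2_conj.

End SteinbergGroup.

Arguments K2 A : clear implicits.
Arguments C2 A : clear implicits.

Section AdditiveSubgroups.
Variable A : comPzRingType.

Definition M_gen : set A :=
  [set y | exists x (a : units A), y = x * (uval a ^+ 2 - 1)] `|`
  [set y | exists b c : units A, y = 3 * (uval b + 1) * (uval c + 1)].

Definition subM : {pred A} := zgen M_gen.
HB.instance Definition _ := GRing.ZmodClosed.on subM.

Definition DS_gen : set A :=
  [set y | exists (d e : A) (t : units A),
     uval t = 1 - d * e /\ y = d * e * (d + e - 3)].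

Definition subN : {pred A} := zsum subM (zgen DS_gen).
HB.instance Definition _ := GRing.ZmodClosed.on subN.

End AdditiveSubgroups.

Arguments subM A : clear implicits.
Arguments subN A : clear implicits.

Section DennisSteinSymbols.
Variable A : comPzRingType.

Definition dennis_stein_symbols : set (St A) :=
  [set p | exists (ij : bool) (a b : A) (t : units A),
     uval t = 1 - a * b /\ p = dennis_stein (@x_ A) ij a b t].

End DennisSteinSymbols.

Arguments dennis_stein_symbols A : clear implicits.

(* Main.v *)
Require Import Defs.
From HB Require Import structures.
From mathcomp Require Import all_boot all_algebra.
From mathcomp Require Import boolp classical_sets.
From mathcomp Require Import ring.

(** Let [phi] be a homomorphism from [St(2,A)] to a group with
    [phi x12(r) = phi x21(-r)], and put [e r := phi x21(r)].  The relations of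
    [St(2,A)] force [e (u^2 r) = e r], whence [phi h12(u) = e (-3(u-1))],
    [phi {u,v} = e (-3(u-1)(v-1))] and
    [phi <a,b>_12 = e (ab(a+b-3))].
    This applies to [St(2,A) -> A/M] and to
    [pr : St(2,A) -> E2(A) -> E2(A)^ab].  For the latter, triviality of [pr] on
    the Steinberg symbols says that [y |-> E12(y)] factors through [A/M]; for
    the former, it says that [K2(2,A) -> A/M] factors through
    [K2(2,A)/C(2,A)].  Composing [St(2,A) -> A/M] with [A/M -> E2(A)^ab] gives
    the pointwise inverse of [pr], and exactness at [A/M] follows by lifting an
    element of the derived subgroup of [E2(A)] to that of [St(2,A)].
    If Dennis-Stein symbols generate [K2(2,A)], the same argument with [N] in
    place of [M] applies: [pr] is trivial on these symbols, so [y |-> E12(y)]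
    factors through [A/N], and [K2(2,A)] has trivial image in [A/N]. *)

Set Implicit Arguments.
Unset Strict Implicit.
Unset Printing Implicit Defensive.

Import GRing.Theory.

Local Open Scope ring_scope.
Local Open Scope quotient_scope.

(** * Maps out of quotient groups *)

Lemma quotg_lift (G H : groupType) (S : normalClosed G)
    (phi : UMagmaMorphism.type G H) :
  (forall x, x \in S -> phi x = 1%g) ->
  exists f : UMagmaMorphism.type (quotg S) H,
    forall x, f (\pi_(quotg S) x) = phi x.
Proof.
move=> phi1; pose f (q : quotg S) : H := phi (repr q).
have fE x : f (\pi_(quotg S) x) = phi x.
  rewrite /f; case: piP => y /quotgP/phi1.
  by rewrite gmulfM gmulfV => /mulg1_eq <-; rewrite invgK.
have fM : monoid.monoid_morphism f.
  split=> [|p q]; first by rewrite (fE 1%g) gmulf1.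
  elim/quotW: p => x; elim/quotW: q => y.
  by rewrite -[(_ * _)%g](pi_quotgM S x y) !fE gmulfM.
pose F := isUMagmaMorphism.Build _ _ f fM.
by exists (HB.pack_for (UMagmaMorphism.type (quotg S) H) f F).
Qed.

(** The zero of the additive quotient is, by conversion, the [1%g] of its multiplicative copy. *)
Lemma quot_pi_eq1 (V : zmodType) (I : zmodClosed V) x :
  x \in I ->
  \pi_(Quotient.quot I) x = (1%g : to_multiplicative (Quotient.quot I)).
Proof.
move=> xI; apply: (etrans _ (@pi_zeror _ _ _ _ _ (Quotient.quot I))).
by apply/eqP; rewrite -Quotient.idealrBE subr0.
Qed.

Lemma quot_lift (V : zmodType) (H : groupType) (I : zmodClosed V) (e : V -> H) :
    (forall x y, e (x + y) = (e x * e y)%g) ->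
    (forall x, x \in I -> e x = 1%g) ->
  exists f : UMagmaMorphism.type (to_multiplicative (Quotient.quot I)) H,
    forall x, f (\pi_(Quotient.quot I) x) = e x.
Proof.
move=> eD e1; pose f (q : to_multiplicative (Quotient.quot I)) : H :=
  e (repr (q : Quotient.quot I)).
have fE x : f (\pi_(Quotient.quot I) x) = e x.
  rewrite /f; case: piP => y /eqP; rewrite -Quotient.idealrBE => /e1 exy.
  by rewrite -[x in RHS](subrK y) eD exy mul1g.
have fM : monoid.monoid_morphism f.
  split=> [|p q].
    by rewrite -(e1 0 (rpred0 I)) -fE; congr f; rewrite quot_pi_eq1 ?rpred0.
  elim/quotW: p => x; elim/quotW: q => y.
  by rewrite -[(_ * _)%g](Quotient.pi_add I x y) !fE eD.
pose F := isUMagmaMorphism.Build _ _ f fM.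
by exists (HB.pack_for
  (UMagmaMorphism.type (to_multiplicative (Quotient.quot I)) H) f F).
Qed.

Lemma ab_commute (G : groupType) (p q : ab G) : commute p q.
Proof.
elim/quotW: p => x; elim/quotW: q => y; rewrite /commute.
rewrite -[LHS](pi_quotgM (derived G) x y) -[RHS](pi_quotgM (derived G) y x).
apply/quotgP; apply/genP/generated_in; exists y => //; exists x => //.
by rewrite commgEl conjgE invgM !mulgA.
Qed.

(** * Homomorphisms out of [St(2,A)] and their values on symbols *)

Section StHom.
Variables (A : comPzRingType) (H : groupType).
Variable phi : UMagmaMorphism.type (St A) H.
Hypothesis phiN : forall r, phi (x_ false r) = phi (x_ true (- r)).

Local Notation e r := (phi (x_ true r)).

Lemma St_hom_xD r s : e (r + s) = (e r * e s)%g.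
Proof. by rewrite -x_D gmulfM. Qed.

Lemma St_hom_w ij u : phi (stein_w (@x_ A) ij u) =
  e ((if ij then 1 else -1) * (uval u *+ 2 + uval u^-1%g)).
Proof.
rewrite /stein_w !gmulfM.
by case: ij; rewrite /= !phiN -!St_hom_xD; congr (e _); ring.
Qed.

(** Apply [phi] to the conjugation relation. [H] may be noncommutative, but by [phiN] everything
    lands in the image of [x21], which is commutative, so the conjugation disappears. *)
Lemma St_hom_sqr (u : units A) r : e (uval u * r * uval u) = e r.
Proof.
have := congr1 phi (x_w false u r); rewrite gmulfM gmulfV phiN opprK => <-.
by rewrite gmulfM !St_hom_w -St_hom_xD addrC St_hom_xD mulgK.
Qed.

(** [St_hom_sqr] trades [u x u] for [x]. Exponents are compared below by exhibiting their difference
    in this form. *)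
Lemma St_hom_mod (u : units A) x r s :
  r - s = x * (uval u ^+ 2 - 1) -> e r = e s.
Proof.
move=> rs; have -> : r = (uval u * x * uval u + (s - x)).
  by rewrite -[r](subrK s) rs; ring.
by rewrite St_hom_xD St_hom_sqr -St_hom_xD addrC subrK.
Qed.

Let uvalKV (u : units A) : uval u * uval u^-1%g = 1.
Proof. exact: uvalK. Qed.

Lemma St_hom_h ij u :
  phi (stein_h (@x_ A) ij u) = e ((if ij then 1 else -1) * 3 * (uval u - 1)).
Proof.
rewrite /stein_h gmulfM !St_hom_w -St_hom_xD.
have -> : uval (unitN1 A) = -1 by [].
have -> : uval (unitN1 A)^-1 = -1 by [].
(* For [ij = 12] the exponents [3 - 2u - u^-1] and [3 - 3u] differ by [u - u^-1 = u^-1 (u^2 - 1)];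
   for 21 the sign flips. *)
apply: (@St_hom_mod u ((if ij then -1 else 1) * uval u^-1%g)).
by case: ij => /=; ring: (uvalKV u).
Qed.

Lemma St_hom_xV r : (e r)^-1%g = e (- r).
Proof. by rewrite -gmulfV x_N. Qed.

Lemma St_hom_symbol u v :
  phi (stein_symbol (@x_ A) u v) = e (- (3 * (uval u - 1) * (uval v - 1))).
Proof.
rewrite /stein_symbol 2!gmulfM !gmulfV !St_hom_h !St_hom_xV -!St_hom_xD uvalM.
by congr (e _); ring.
Qed.

Lemma St_hom_dennis_stein ij a b t : uval t = 1 - a * b ->
  phi (dennis_stein (@x_ A) ij a b t) =
  e ((if ij then -1 else 1) * (a * b * (a + b - 3))).
Proof.
move=> tE; rewrite /dennis_stein 4!gmulfM gmulfV St_hom_h St_hom_xV.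
have abE : a * b = 1 - uval t by rewrite tE; ring.
(* For 12 the exponent is [(a+b)(1 - t^-1) - 3ab], the target [(a+b)(1 - t) - 3ab]; they differ by
   [(a+b) t^-1 (t^2 - 1)]. *)
case: ij; rewrite /= !phiN -!St_hom_xD.
  by apply: (@St_hom_mod t (- (a + b) * uval t^-1%g)); ring: (uvalKV t) abE.
by apply: (@St_hom_mod t ((a + b) * uval t^-1%g)); ring: (uvalKV t) abE.
Qed.

End StHom.

(** * Derived subgroups under homomorphisms *)

Section HomToCommutative.
Variables (G H : groupType) (phi : UMagmaMorphism.type G H).

Lemma commutative_hom_derived :
    (forall p q : H, commute p q) ->
  forall x, x \in derived G -> phi x = 1%g.
Proof.
move=> cH x /genP; elim=> {x} [_ [x _ [y _ <-]]||x y _ px _ py|x _ px].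
- by rewrite gmulfR; apply/eqP/commgP/cH.
- exact: gmulf1.
- by rewrite gmulfM px py mulg1.
- by rewrite gmulfV px invg1.
Qed.

Lemma derived_lift :
    (forall y, exists x, phi x = y) ->
  forall y, y \in derived H -> exists2 x, x \in derived G & phi x = y.
Proof.
move=> phi_surj y /genP; elim=> {y} [_ [y _ [z _ <-]]||y z _|y _].
- have [[y' <-] [z' <-]] := (phi_surj y, phi_surj z).
  exists [~ y', z']%g; last exact: gmulfR.
  by apply/genP/generated_in; exists y' => //; exists z'.
- by exists 1%g; rewrite ?gpred1 ?gmulf1.
- move=> [y' dy <-] _ [z' dz <-].
  by exists (y' * z')%g; rewrite ?gpredM ?gmulfM.
- by move=> [y' dy <-]; exists (y'^-1)%g; rewrite ?gpredV ?gmulfV.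
Qed.

End HomToCommutative.

(** * The exact sequence: membership in [M] and the map to [E2(A)^ab] *)

Section ExactSequence.
Variable A : comPzRingType.

Lemma subM_sqr (a : units A) x : x * (uval a ^+ 2 - 1) \in subM A.
Proof. by apply/zgenP/zgenerated_in; left; exists x, a. Qed.

Lemma subM_symbol (u v : units A) :
  3 * (uval u - 1) * (uval v - 1) \in subM A.
Proof.
apply/zgenP/zgenerated_in; right.
(* With [b = -u] and [c = -v], [(b+1)(c+1) = (u-1)(v-1)]. *)
exists (unitN1 A * u)%g, (unitN1 A * v)%g.
by rewrite !uvalM (_ : uval (unitN1 A) = -1) //; ring.
Qed.

Lemma St_E2_surj (g : subg (E2 A)) : exists p, St_E2 p = g.
Proof.
suff [p pg] : exists p, val (St_E2 p) = val g by exists p; apply: val_inj.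
case: g => m /= /genP; elim=> {m} [_ [ij _ [r _ <-]]||m n _|m _].
- by exists (x_ ij r); rewrite St_E2_x.
- by exists 1%g; rewrite gmulf1.
- by move=> [p <-] _ [q <-]; exists (p * q)%g; rewrite St_E2M.
- by move=> [p <-]; exists (p^-1)%g; rewrite St_E2V.
Qed.

Definition St_E2ab : UMagmaMorphism.type (St A) (ab (subg (E2 A))) :=
  \pi_(ab (subg (E2 A))) \o @St_E2 A.

Lemma St_E2ab_x ij r :
  St_E2ab (x_ ij r) = \pi_(ab (subg (E2 A))) (elem_E2 ij r).
Proof. by rewrite /= St_E2_x. Qed.

(** This is the conjugation relation at [u = 1], read in a commutative group; it supplies [phiN] for
    [St_E2ab]. *)
Lemma St_E2abN r : St_E2ab (x_ false r) = St_E2ab (x_ true (- r)).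
Proof.
have := congr1 St_E2ab (x_w true (unit1 A) r).
rewrite gmulfM gmulfV gmulfM ab_commute mulKg => ->.
by rewrite /= mul1r mulr1.
Qed.

(** * The map [St(2,A) -> A/S], to be used for both [S = M] and [S = N] *)

Section WeightHom.
Variable S : zmodClosed A.
Hypothesis sMS : {subset subM A <= S}.

(** In a commutative target [w] cancels from the conjugation relation. Thanks to the opposite signs
    on [x12] and [x21], what remains is [r (u^2 - 1)] up to sign, which lies in [M]. *)
Lemma weight_hom_exists :
  exists psi : UMagmaMorphism.type (St A) (to_multiplicative (Quotient.quot S)),
    forall r, psi (x_ false r) = \pi_(Quotient.quot S) (- r) /\
              psi (x_ true r) = \pi_(Quotient.quot S) r.
Proof.
pose f (X : bool * A) : to_multiplicative (Quotient.quot S) :=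
  \pi_(Quotient.quot S) (if X.1 then X.2 else - X.2).
have fR a b : St_rel a b -> word_eval f a = word_eval f b.
  case=> [ij r t|ij u r].
    rewrite -[LHS]Quotient.pi_add /=; congr (\pi_(Quotient.quot S) _).
    by case: ij; rewrite -?opprD.
  rewrite -[LHS]/(word_eval f (stein_w (@St_word A) ij u) * f (~~ ij, r)
                  * (word_eval f (stein_w (@St_word A) ij u))^-1)%g.
  rewrite [(word_eval _ _ * _)%g]Algebra.commuteT mulgK; apply/eqP.
  rewrite -Quotient.idealrBE.
  case: ij => /=; last rewrite opprK -opprB rpredN;
    by rewrite (_ : _ - _ = r * (uval u ^+ 2 - 1)) ?sMS ?subM_sqr //; ring.
pose psi := @pres_lift _ (@St_rel A) _ f.
pose F := isUMagmaMorphism.Build _ _ psi (pres_lift_is_morphism fR).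
exists (HB.pack_for
  (UMagmaMorphism.type (St A) (to_multiplicative (Quotient.quot S))) psi F).
by move=> r; split; apply: (pres_lift_gen fR).
Qed.

Variable psi : UMagmaMorphism.type (St A) (to_multiplicative (Quotient.quot S)).
Hypothesis psi_x : forall r,
  psi (x_ false r) = \pi_(Quotient.quot S) (- r) /\
  psi (x_ true r) = \pi_(Quotient.quot S) r.

Lemma weight_homN r : psi (x_ false r) = psi (x_ true (- r)).
Proof. by rewrite (psi_x r).1 (psi_x (- r)).2. Qed.

Lemma K2_quot_exact :
    (forall y, y \in S -> St_E2ab (x_ false y) = 1%g) ->
  exists g : UMagmaMorphism.type (to_multiplicative (Quotient.quot S))
                                 (ab (subg (E2 A))),
  [/\ forall y, g (\pi_(Quotient.quot S) y) =
                \pi_(ab (subg (E2 A))) (elem_E2 false y),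
      forall y, g y = 1%g <-> exists2 k, k \in K2 A & psi k = y
    & forall z, exists y, g y = z].
Proof.
move=> killS.
have eD r s : St_E2ab (x_ false (r + s))
            = (St_E2ab (x_ false r) * St_E2ab (x_ false s))%g.
  by rewrite -x_D gmulfM.
have [g gE] := quot_lift eD killS.
(* The inverse appears because [psi] sends [x12(r)] to [-r] while [g] sends [r] to [E12(r)]. *)
have g_psi p : g (psi p) = (St_E2ab p)^-1%g.
  elim/St_ind: p => [[] r||p q pE qE|p pE].
  - by rewrite (psi_x r).2 gE St_E2abN x_N gmulfV.
  - by rewrite (psi_x r).1 gE x_N gmulfV.
  - by rewrite !gmulf1 invg1.
  - by rewrite !gmulfM pE qE invgM ab_commute.
  - by rewrite !gmulfV pE.
exists g; split=> [y|y|z].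
- by rewrite gE St_E2ab_x.
- split=> [|[k /eqP kK <-]]; last by rewrite g_psi /= kK gmulf1 invg1.
  elim/quotW: y => y; rewrite gE St_E2ab_x => /quotgP.
  case/(derived_lift St_E2_surj) => p dp pE.
  (* [p] lies over [E12(y)^-1], so the product is in [K2]. As [psi] kills [p], it sends the product
     to [-y], whence the inverse. *)
  exists ((p * x_ false y)^-1)%g.
    rewrite gpredV; apply/eqP; rewrite St_E2M St_E2_x.
    by apply: etrans (congr1 (fun q => q * _)%g pE) _; rewrite mulg1 mulVg.
  have psi_p : psi p = 1%g.
    by apply: commutative_hom_derived dp => a b; apply: Algebra.commuteT.
  rewrite gmulfV gmulfM psi_p mul1g.
  by rewrite -gmulfV -x_N (psi_x (- y)).1 opprK.
- elim/quotW: z => z; have [p pz] := St_E2_surj z.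
  by exists (psi p^-1)%g; rewrite g_psi gmulfV invgK /= pz.
Qed.

End WeightHom.

(** * Vanishing on [M], [N] and Dennis-Stein symbols *)

Lemma St_E2ab_K2 k : k \in K2 A -> St_E2ab k = 1%g.
Proof. by move=> /eqP kK; rewrite /= kK gmulf1. Qed.

Lemma St_E2ab_subM y : y \in subM A -> St_E2ab (x_ true y) = 1%g.
Proof.
move/zgenP; elim=> {y} [_ [[x [a ->]]|[b [c ->]]]||x y _ xE _ yE|x _ xE].
- transitivity (St_E2ab (x_ true 0)); last by rewrite x_0 gmulf1.
  by apply: (St_hom_mod St_E2abN (u := a) (x := x)); rewrite subr0.
- rewrite -[3 * _ * _]opprK x_N gmulfV.
  (* The symbol [{-b,-c}] has exponent [-3(b+1)(c+1)], and it dies because it lies in [K2]. *)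
  have := St_hom_symbol St_E2abN (unitN1 A * b)%g (unitN1 A * c)%g.
  rewrite St_E2ab_K2 ?stein_symbol_K2 // !uvalM (_ : uval (unitN1 A) = -1) //.
  rewrite (_ : - _ = - (3 * (uval b + 1) * (uval c + 1))); last by ring.
  by move=> <-; rewrite invg1.
- by rewrite x_0 gmulf1.
- by rewrite -x_D gmulfM xE yE mulg1.
- by rewrite x_N gmulfV xE invg1.
Qed.

Lemma St_E2ab_DS_gen y : y \in zgen (@DS_gen A) -> St_E2ab (x_ true y) = 1%g.
Proof.
move/zgenP; elim=> {y} [_ [d [e [t [tE ->]]]]||x y _ xE _ yE|x _ xE].
- rewrite -[d * e * _]mul1r -(St_hom_dennis_stein St_E2abN false tE).
  exact/St_E2ab_K2/dennis_stein_K2.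
- by rewrite x_0 gmulf1.
- by rewrite -x_D gmulfM xE yE mulg1.
- by rewrite x_N gmulfV xE invg1.
Qed.

Lemma St_E2ab_subN y : y \in subN A -> St_E2ab (x_ true y) = 1%g.
Proof.
case/zsumP=> s [t [sM tD ->]].
by rewrite -x_D gmulfM St_E2ab_subM // St_E2ab_DS_gen // mulg1.
Qed.

Lemma weight_hom_dennis_stein
    (psi : UMagmaMorphism.type (St A)
             (to_multiplicative (Quotient.quot (subN A)))) :
    (forall r, psi (x_ false r) = \pi_(Quotient.quot (subN A)) (- r) /\
               psi (x_ true r) = \pi_(Quotient.quot (subN A)) r) ->
  forall k, k \in gen (dennis_stein_symbols A) -> psi k = 1%g.
Proof.
move=> psi_x k /genP.
elim=> {k} [_ [ij [a [b [t [tE ->]]]]]||p q _ pE _ qE|p _ pE].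
- rewrite (St_hom_dennis_stein (weight_homN psi_x) ij tE) (psi_x _).2.
  apply: quot_pi_eq1; suff dsN : a * b * (a + b - 3) \in subN A.
    by case: ij; rewrite ?mulN1r ?mul1r ?rpredN.
  apply/zsumP; exists 0, (a * b * (a + b - 3)).
  rewrite rpred0 add0r; split=> //.
  by apply/zgenP/zgenerated_in; exists a, b, t.
- exact: gmulf1.
- by rewrite gmulfM pE qE mulg1.
- by rewrite gmulfV pE invg1.
Qed.

Lemma subM_subN : {subset subM A <= subN A}.
Proof. by move=> y yM; apply/zsumP; exists y, 0; rewrite rpred0 addr0. Qed.

End ExactSequence.

Theorem corollary3p5 (A : comPzRingType) :
  (exists (psi : {multiplicative St A ->
                    to_multiplicative (Quotient.quot (subM A))})
          (f : {multiplicative quotg (C2 A) ->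
                  to_multiplicative (Quotient.quot (subM A))})
          (g : {multiplicative to_multiplicative (Quotient.quot (subM A)) ->
                  ab (subg (E2 A))}),
     [/\ forall r : A, psi (x_ false r) = \pi_(Quotient.quot (subM A)) (- r)
                    /\ psi (x_ true r) = \pi_(Quotient.quot (subM A)) r,
         forall k : subg (K2 A), f (\pi_(quotg (C2 A)) k) = psi (val k),
         forall y : A, g (\pi_(Quotient.quot (subM A)) y) =
                       \pi_(ab (subg (E2 A))) (elem_E2 false y),
         forall y, g y = 1%g <-> exists x, f x = y
       & forall z, exists y, g y = z])
  /\
  (K2 A =i gen (dennis_stein_symbols A) ->
   exists f : {multiplicative ab (subg (E2 A)) ->
                 to_multiplicative (Quotient.quot (subN A))},
     bijective f).
Proof.
split=> [|K2_DS].
  have sMM : {subset subM A <= subM A} by [].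
  have [psi psi_x] := weight_hom_exists sMM.
  have killM y : y \in subM A -> St_E2ab A (x_ false y) = 1%g.
    by move=> yM; rewrite St_E2abN St_E2ab_subM ?rpredN.
  have [g [gE g1 g_surj]] := K2_quot_exact psi_x killM.
  pose psiK : UMagmaMorphism.type (subg (K2 A)) _ := psi \o val.
  have psi_C2 k : k \in C2 A -> psiK k = 1%g.
    move/genP; elim=> {k} [_ [u _ [v _ <-]]||p q _ pE _ qE|p _ pE].
    - rewrite /= (St_hom_symbol (weight_homN psi_x)) (psi_x _).2.
      by rewrite quot_pi_eq1 // rpredN subM_symbol.
    - exact: gmulf1.
    - by rewrite gmulfM pE qE mulg1.
    - by rewrite gmulfV pE invg1.
  have [f fE] := quotg_lift psi_C2.
  exists psi, f, g; split=> // y; split=> [/g1[k kK <-]|[x <-]].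
    by exists (\pi_(quotg (C2 A)) (Subg kK)); rewrite fE.
  elim/quotW: x => k; apply/g1; exists (val k); last by rewrite fE.
  exact: valP.
have [psi psi_x] := weight_hom_exists (@subM_subN A).
have killN y : y \in subN A -> St_E2ab A (x_ false y) = 1%g.
  by move=> yN; rewrite St_E2abN St_E2ab_subN ?rpredN.
have [g [_ g1 g_surj]] := K2_quot_exact psi_x killN.
(* By exactness the kernel of [g] is [psi(K2)], which is trivial since Dennis-Stein symbols generate
   [K2]. *)
have g_inj : injective g.
  apply: gmulf_inj => y /g1[k]; rewrite K2_DS => kDS <-.
  exact: weight_hom_dennis_stein psi_x _ kDS.
(* The required map runs opposite to [g]: a section of [g], two-sided inverse by injectivity and
   hence multiplicative. *)
have [h gK] := choice g_surj.
have hK : cancel g h by move=> y; apply: g_inj; rewrite gK.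
pose F := isMultiplicative.Build _ _ h (can2_gmulfM hK gK).
exists (HB.pack_for {multiplicative ab (subg (E2 A)) ->
                       to_multiplicative (Quotient.quot (subN A))} h F).
by exists g.
Qed.
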